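(* Let $M\ge 1$ be an integer. For each $q\in(1,M+1]$, \[ \dim_H \mathcal U_q=\frac{h(\mathbf U_q)}{\log q}, \] where $\dim_H$ denotes Hausdorff dimension of subsets of $\mathbb R$ (Euclidean metric).
   Context: Fix an integer $M\ge 1$ and let $\Omega:=\{0,1,\dots,M\}^{\mathbb N}$. For $q\in(1,M+1]$ let $I_q:=[0,M/(q-1)]$ and $\pi_q(x_1x_2\dots):=\sum_{j\ge1}x_jq^{-j}$ for $(x_i)\in\Omega$. A $q$-expansion of $x\in I_q$ is a sequence $(x_i)\in\Omega$ with $\pi_q((x_i))=x$. The univoque set is $\mathcal U_q:=\{x\in I_q: x \text{ has exactly one } q\text{-expansion}\}$, and the symbolic univoque set is $\mathbf U_q:=\pi_q^{-1}(\mathcal U_q)\subseteq\Omega$. For $X\subseteq\Omega$, $B_k(X)$ is the set of all words of length $k$ which occur (as blocks of consecutive digits, at any position) in some sequence in $X$, and the topological entropy of $X$ is $h(X):=\lim_{k\to\infty}\frac{\log\#B_k(X)}{k}=\inf_{k\in\mathbb N}\frac{\log\#B_k(X)}{k}$ (the limit exists and equals the infimum by subadditivity). *)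

(* Defs.v *)
From HB Require Import structures.
From mathcomp Require Import all_boot all_order all_algebra.
From mathcomp Require Import all_classical all_reals all_analysis.

Set Implicit Arguments.
Unset Strict Implicit.
Unset Printing Implicit Defensive.

Import Order.TTheory GRing.Theory Num.Theory.
Import numFieldNormedType.Exports.

Local Open Scope classical_set_scope.
Local Open Scope ring_scope.

Section hausdorff.
Variable R : realType.

(* Euclidean diameter; equal to -oo on the empty set. *)
Definition diameter (U : set R) : \bar R :=
  ereal_sup [set `|z.1 - z.2|%:E | z in U `*` U].

(* |U|^s, where |set0|^s = 0 for every s (including s = 0) and
   |U|^0 = 1 for every nonempty U. *)
Definition diameter_pow (s : R) (U : set R) : \bar R :=
  if U == set0 then 0%E else poweR (diameter U) s.

(* Countable covers by arbitrary sets of diameter at most d; finite covers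
   are obtained by padding with set0. *)
Definition delta_cover (d : R) (A : set R) (U : (set R)^nat) : Prop :=
  A `<=` \bigcup_i U i /\ forall i, (diameter (U i) <= d%:E)%E.

Definition hausdorff_premeasure (s d : R) (A : set R) : \bar R :=
  ereal_inf [set (\sum_(0 <= i <oo) diameter_pow s (U i))%E
            | U in delta_cover d A].

Definition hausdorff_measure (s : R) (A : set R) : \bar R :=
  ereal_sup [set hausdorff_premeasure s d A | d in [set d : R | 0 < d]].

Definition hausdorff_dim (A : set R) : \bar R :=
  ereal_inf [set s%:E | s in [set s : R | 0 <= s /\
                                          hausdorff_measure s A = 0%E]].

End hausdorff.

(* The digit written x_(j+1) on paper is [x j]. *)
Definition Omega (M : nat) : Type := nat -> 'I_M.+1.

Definition block (M k : nat) (x : Omega M) (i : nat) : k.-tuple 'I_M.+1 :=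
  [tuple x (i + j)%N | j < k].

Definition blocks (M k : nat) (X : set (Omega M)) : {set k.-tuple 'I_M.+1} :=
  [set w | `[< exists x : Omega M, X x /\ exists i, w = block k x i >]]%SET.

(* For nonempty X the limit exists by subadditivity (Fekete). *)
Definition entropy (R : realType) (M : nat) (X : set (Omega M)) : R :=
  limn (fun k : nat => ln (#|blocks k X|%:R : R) / k%:R).

Section univoque.
Variables (R : realType) (M : nat) (q : R).

Definition base_interval : set R := `[0, M%:R / (q - 1)]%classic.

(* The shift of indices in [Omega] turns x_j q^(-j), j >= 1, into
   x_j q^(-(j+1)), j >= 0. *)
Definition expansion_value (x : Omega M) : R :=
  limn (series (fun j : nat => (x j : nat)%:R * q ^- j.+1)).

Definition is_expansion (a : R) (x : Omega M) : Prop := expansion_value x = a.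

Definition univoque_set : set R :=
  [set a | base_interval a /\ exists! x : Omega M, is_expansion a x].

Definition symbolic_univoque_set : set (Omega M) :=
  expansion_value @^-1` univoque_set.

End univoque.

Arguments symbolic_univoque_set {R} M q.
Arguments univoque_set {R} M q.

(* Main.v *)
(* Let T = M / (q - 1) and let V be the set of sequences x such that every tail
   y following a digit < M has value <= 1 and every tail following a digit >
   0 has value >= T - 1. V is closed and shift-invariant, contains the
   symbolic univoque set, and its values exceed the univoque set only by a
   countable set. Upper bound: cover the univoque set by the cylinders of
   its blocks of length k. Lower bound: two sequences of V whose values are
   within a constant times q^(-k) share their first k digits (when q < M +
   1; at most three prefixes of length k occur when q = M + 1), so a cover
   of the univoque set by small sets, together with tiny words around the
   countably many exceptional points, becomes a cover of the compact set V
   by cylinders. By Furstenberg's argument a finite family W of words with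
   sum_(w in W) q^(-s |w|) <= 1, one of which is a prefix of every element
   of V, forces #B_k(V) <= C q^(sk). The two bounds sandwich log #B_k / k
   between its own lower and upper limits, so its convergence comes for
   free. *)

Require Import Defs.
From mathcomp Require Import all_boot all_order all_algebra.
From mathcomp Require Import all_classical all_reals all_analysis.
From mathcomp Require Import lra ring zify.

Set Implicit Arguments.
Unset Strict Implicit.
Unset Printing Implicit Defensive.

Import Order.TTheory GRing.Theory Num.Theory.
Import numFieldNormedType.Exports.

Local Open Scope classical_set_scope.
Local Open Scope ring_scope.

(** * Words, prefix counts and compactness of the full shift *)

Section words.
Variable M : nat.
Implicit Types (x y : Omega M) (V : set (Omega M)) (u w : seq 'I_M.+1).

Definition shift (n : nat) (x : Omega M) : Omega M := fun j => x (n + j)%N.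

Definition occurs (w : seq 'I_M.+1) (x : Omega M) := mkseq x (size w) = w.

Lemma shiftD m n x : shift m (shift n x) = shift (n + m) x.
Proof. by apply/funext => j; rewrite /shift addnA. Qed.

Lemma mkseq_shift x n k :
  mkseq x (n + k) = mkseq x n ++ mkseq (shift n x) k.
Proof.
rewrite /mkseq iotaD map_cat; congr (_ ++ _).
by rewrite add0n -[X in iota X _]addn0 iotaDl -map_comp.
Qed.

Lemma mkseq_eqP x y k :
  mkseq x k = mkseq y k <-> (forall j, (j < k)%N -> x j = y j).
Proof.
split=> [e j jk|e]; last first.
  by apply/eq_in_map => j; rewrite mem_iota add0n; exact: e.
by move: (congr1 (fun s => nth (x j) s j) e); rewrite !nth_mkseq.
Qed.

Lemma val_block k x i : val (block k x i) = mkseq (shift i x) k.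
Proof.
apply: (@eq_from_nth _ ord0); rewrite size_tuple ?size_mkseq// => j jk.
rewrite nth_mkseq// -[j in nth _ _ j]/(nat_of_ord (Ordinal jk)) -tnth_nth.
by rewrite tnth_mktuple.
Qed.

(* A long prefix of a sequence of [V] is a word of [W] followed by a shorter
   such prefix, so the generating function of [W] controls the growth. *)
Lemma prefix_count (R : realType) V (r : R) (W : seq (seq 'I_M.+1)) :
  0 <= r <= 1 ->
  (forall x n, V x -> V (shift n x)) ->
  (forall w, w \in W -> (0 < size w)%N) ->
  (forall x, V x -> exists2 w, w \in W & occurs w x) ->
  \sum_(w <- W) r ^+ size w <= 1 ->
  exists C : R, forall k (S : seq (seq 'I_M.+1)), uniq S ->
    (forall w, w \in S -> exists2 x, V x & mkseq x k = w) ->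
    (size S)%:R * r ^+ k <= C.
Proof.
move=> /andP[r0 r1] Vshift W0 Vcov Wle1.
pose L := \max_(w <- W) size w.
have WL w : w \in W -> (size w <= L)%N by move=> wW; exact: leq_bigmax_seq.
(* For [k < L] the crude count [(M + 1) ^ k] and [r <= 1] suffice; from [L] on, the bound is
   inherited because the weights of [W] sum to at most 1. *)
exists ((M.+1 ^ L)%N%:R); elim/ltn_ind => k IH S uS Sp.
have [kL|Lk] := ltnP k L.
  have szS : (size S <= M.+1 ^ k)%N.
    have := @uniq_leq_size _ S [seq val t | t : k.-tuple 'I_M.+1] uS.
    rewrite size_map -cardE card_tuple card_ord; apply=> w /Sp[x _ <-].
    have sz : size (mkseq x k) == k by rewrite size_mkseq.
    by apply/mapP; exists (Tuple sz) => //; rewrite mem_enum.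
  apply: (@le_trans _ _ (size S)%:R).
    by rewrite ler_piMr// exprn_ile1.
  by rewrite ler_nat (leq_trans szS)// leq_pexp2l// ltnW.
(* What remains of the words of [S] that start with [w]. By shift invariance these are again
   prefixes of elements of [V], so the induction hypothesis applies at [k - size w]. *)
pose Sw w := [seq drop (size w) u | u <- S & take (size w) u == w].
have szS : (size S <= \sum_(w <- W) size (Sw w))%N.
  rewrite [leqRHS](_ : _ = \sum_(u <- S) \sum_(w <- W) (take (size w) u ==
    w))%N.
    rewrite -sum1_size big_seq [leqRHS]big_seq; apply: leq_sum => u uS'.
    have [x Vx xu] := Sp u uS'.
    have [w wW wx] := Vcov x Vx.
    have e : take (size w) u == w.
      apply/eqP; rewrite -xu -(subnKC (leq_trans (WL w wW) Lk)) mkseq_shift.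
      by rewrite take_size_cat ?size_mkseq.
    by rewrite (big_rem w)//= e.
  rewrite exchange_big /=; apply: eq_bigr => w _.
  by rewrite size_map size_filter -sum1_count big_mkcond.
have Sb w : w \in W -> (size (Sw w))%:R * r ^+ (k - size w) <= (M.+1 ^ L)%N%:R.
  move=> wW; apply: IH.
  - by have := W0 w wW; have := leq_trans (WL w wW) Lk; lia.
  - rewrite map_inj_in_uniq ?filter_uniq// => u v.
    rewrite !mem_filter => /andP[/eqP eu _] /andP[/eqP ev _] euv.
    by rewrite -(cat_take_drop (size w) u) -(cat_take_drop (size w) v) eu ev
      euv.
  - move=> _ /mapP[u + ->]; rewrite mem_filter => /andP[_ /Sp[x Vx <-]].
    exists (shift (size w) x); first exact: Vshift.
    rewrite -{2}(subnKC (leq_trans (WL w wW) Lk)) mkseq_shift.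
    by rewrite drop_size_cat ?size_mkseq.
apply: (@le_trans _ _ (\sum_(w <- W) r ^+ size w * (M.+1 ^ L)%N%:R)).
  apply: (@le_trans _ _ ((\sum_(w <- W) size (Sw w))%N%:R * r ^+ k)).
    by rewrite ler_wpM2r ?exprn_ge0// ler_nat.
  rewrite natr_sum mulr_suml big_seq [leRHS]big_seq; apply: ler_sum => w wW.
  rewrite -{1}(subnKC (leq_trans (WL w wW) Lk)) exprD mulrCA.
  by rewrite ler_wpM2l ?exprn_ge0// Sb.
by rewrite -mulr_suml ler_piMl.
Qed.

(* König's lemma for the full shift. *)
Lemma finite_subcover V (W : nat -> seq (seq 'I_M.+1)) :
  (forall x, (forall k, exists2 y, V y & mkseq y k = mkseq x k) -> V x) ->
  (forall x, V x -> exists i, exists2 w, w \in W i & occurs w x) ->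
  exists N, forall x, V x ->
    exists2 i, (i < N)%N & exists2 w, w \in W i & occurs w x.
Proof.
move=> Vclosed Vcov.
(* Every bad word has a bad extension by one letter, since the alphabet is finite. A bad empty word
   would thus yield a sequence all of whose prefixes are bad. *)
pose good u := exists N, forall x, V x -> occurs u x ->
    exists2 i, (i < N)%N & exists2 w, w \in W i & occurs w x.
have goodS u : (forall a, good (rcons u a)) -> good u.
  move=> /choice[N HN]; exists (\max_a N a) => x Vx ux.
  have [|i iN ?] := HN (x (size u)) x Vx.
    by rewrite /occurs size_rcons mkseqS ux.
  by exists i => //; rewrite (leq_trans iN)// (leq_bigmax (x (size u))).
suff [N HN] : good [::] by exists N => x Vx; exact: HN.
apply: contrapT => bad0.
have /choice[f Hf] : forall u, exists a, ~ good u -> ~ good (rcons u a).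
  move=> u; have [gu|bu] := pselect (good u); first by exists ord0.
  by have /existsNP[a ?] := contra_not (@goodS u) bu; exists a.
pose us := fix us n := if n is n'.+1 then rcons (us n') (f (us n')) else [::].
have bad n : ~ good (us n) by elim: n => [//|n IHn] /=; exact: Hf.
pose x : Omega M := fun n => f (us n).
have xE n : mkseq x n = us n.
  by elim: n => [//|n IHn]; rewrite mkseqS IHn.
(* A prefix that starts no element of [V] would be vacuously good with [N = 0], so [x] is a limit of
   elements of [V]. *)
have Vx : V x.
  apply: Vclosed => k; apply: contrapT => nV; apply: (bad k).
  exists 0%N => y Vy; rewrite /occurs -xE size_mkseq => e.
  by case: nV; exists y.
have [i [w wW wx]] := Vcov x Vx.
apply: (bad (size w)); exists i.+1 => y Vy; rewrite -xE wx => wy.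
by exists i => //; exists w.
Qed.

End words.

(** * Values of digit sequences and existence of expansions *)

Section expansions.
Variables (R : realType) (M : nat) (q : R).
Hypotheses (q1 : 1 < q) (qM : q <= M.+1%:R).
Implicit Types (x y : Omega M).

Local Notation T := (M%:R / (q - 1)).
Local Notation pi := (expansion_value q).

Definition psum (n : nat) (x : Omega M) : R :=
  series (fun j : nat => (x j : nat)%:R * q ^- j.+1) n.

Let q0 : 0 < q. Proof. exact: lt_trans q1. Qed.
Let qB1 : 0 < q - 1. Proof. by rewrite subr_gt0. Qed.
Let T0 : 0 <= T. Proof. by rewrite divr_ge0// ltW. Qed.
Let qV0 n : 0 < q ^- n. Proof. by rewrite invr_gt0 exprn_gt0. Qed.

(** A reformulation of [q <= M + 1]: the intervals [[d, d + T]] of consecutive digits leave no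
    gaps. *)
Lemma tail_ge1 : 1 <= T.
Proof. by rewrite ler_pdivlMr// mul1r lerBlDr natr1. Qed.

Lemma psum0 x : psum 0 x = 0.
Proof. by rewrite /psum /series /= big_geq. Qed.

Lemma psumS n x : psum n.+1 x = psum n x + (x n : nat)%:R * q ^- n.+1.
Proof. by rewrite /psum seriesSr. Qed.

Lemma psumD n m x : psum (n + m) x = psum n x + q ^- n * psum m (shift n x).
Proof.
elim: m => [|m IHm]; first by rewrite addn0 psum0 mulr0 addr0.
rewrite addnS !psumS IHm mulrDr -addrA; congr (_ + (_ + _)).
by rewrite /shift mulrCA -invfM -exprD addnS.
Qed.

Lemma eq_psum n x y : (forall j, (j < n)%N -> x j = y j) -> psum n x = psum n y.
Proof.
move=> e; rewrite /psum /series /=; apply: eq_big_nat => j /andP[_ jn].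
by rewrite e.
Qed.

(** The bound is the partial sum of the constant sequence [M]; this exact geometric form lets the
    induction close. *)
Lemma psum_le n x : psum n x <= T * (1 - q ^- n).
Proof.
elim: n => [|n IHn].
  by rewrite psum0 expr0 invr1 subrr mulr0.
have xM : (x n : nat)%:R * q ^- n.+1 <= M%:R * q ^- n.+1.
  by rewrite ler_wpM2r ?(ltW (qV0 _))// ler_nat -ltnS ltn_ord.
rewrite psumS (le_trans (lerD IHn xM))// le_eqVlt; apply/orP; left; apply/eqP.
rewrite exprS invfM; field.
by rewrite expf_neq0 ?gt_eqF// subr_eq0 gt_eqF.
Qed.

Lemma psum_nd x : nondecreasing_seq (psum ^~ x).
Proof.
apply/nondecreasing_seqP => n; rewrite psumS lerDl mulr_ge0//; exact: ltW.
Qed.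

Lemma psum_is_cvg x : cvgn (psum ^~ x).
Proof.
apply: nondecreasing_is_cvgn; first exact: psum_nd.
exists T => _ [n _ <-]; rewrite (le_trans (psum_le n x))// ler_piMr//.
by rewrite gerBl ltW.
Qed.

Lemma psum_cvg x : psum ^~ x @ \oo --> pi x.
Proof. exact: psum_is_cvg. Qed.

Lemma value_ge0 x : 0 <= pi x.
Proof.
apply: limr_ge; first exact: psum_is_cvg.
apply: nearW => n; by rewrite -(psum0 x) psum_nd.
Qed.

Lemma value_le x : pi x <= T.
Proof.
apply: limr_le; first exact: psum_is_cvg.
apply: nearW => n; rewrite (le_trans (psum_le n x))// ler_piMr//.
by rewrite gerBl ltW.
Qed.

Lemma value_split n x : pi x = psum n x + q ^- n * pi (shift n x).
Proof.
have e : (fun m => psum (m + n)%N x) = (fun m => psum n x + q ^- n * psum m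
  (shift n x)).
  by apply/funext => m; rewrite addnC psumD.
have c1 : psum (m + n)%N x @[m --> \oo] --> pi x.
  by rewrite (cvg_shiftn n (psum ^~ x)); exact: psum_cvg.
rewrite e in c1; rewrite -(cvg_lim _ c1)//; apply: cvg_lim => //.
by apply: cvgD; [exact: cvg_cst|apply: cvgMr; exact: psum_cvg].
Qed.

Lemma value_first x : pi x = ((x 0%N : nat)%:R + pi (shift 1 x)) / q.
Proof.
rewrite (value_split 1) psumS psum0 add0r expr1.
by rewrite mulrDl [_^-1 * _]mulrC.
Qed.

Lemma value_shift n x : pi (shift n x) = ((x n : nat)%:R + pi (shift n.+1 x))
  / q.
Proof. by rewrite value_first shiftD addn1 /shift addn0. Qed.

Lemma value_dist n x y : (forall j, (j < n)%N -> x j = y j) ->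
  `|pi x - pi y| <= T * q ^- n.
Proof.
move=> e; rewrite (value_split n x) (value_split n y) (eq_psum e).
rewrite opprD addrACA subrr add0r -mulrBr normrM gtr0_norm//
  mulrC ler_wpM2r ?(ltW (qV0 n))//.
have := value_ge0 (shift n x); have := value_le (shift n x).
have := value_ge0 (shift n y); have := value_le (shift n y).
by move=> *; rewrite ler_norml; apply/andP; split; lra.
Qed.

Lemma qV_cvg0 : q ^- n @[n --> \oo] --> 0.
Proof.
under eq_fun do rewrite -exprVn.
by apply: cvg_expr; rewrite gtr0_norm ?invr_gt0// invf_lt1.
Qed.

Lemma small_qV e : 0 < e -> exists n, q ^- n < e.
Proof.
move=> e0; have [N _ /(_ N (leqnn _))] := cvgr_lt _ qV_cvg0 _ e0.
by exists N.
Qed.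

(* The greedy algorithm; [q <= M + 1] keeps the remainders in [[0, T]]. *)
Lemma expansion_exists a : 0 <= a <= T -> exists x, pi x = a.
Proof.
move=> a01.
pose dig (t : R) : 'I_M.+1 :=
  [arg max_(d > ord0 | (d : nat)%:R <= q * t) (d : nat)].
pose next t := q * t - (dig t : nat)%:R.
have nextP t : 0 <= t <= T -> 0 <= next t <= T.
  move=> /andP[t0 tT]; rewrite /next /dig; case: arg_maxnP.
    by rewrite mulr_ge0// ltW.
  move=> d dt dmax; rewrite subr_ge0 dt /=.
  (* Below [M], maximality of [d] leaves a remainder of at most 1, hence at most [T]; at [d = M] the
     remainder is at most [q * T - M = T]. *)
  have [dM|] := ltnP d M.
    have d1M : (d.+1 < M.+1)%N by [].
    rewrite (le_trans _ tail_ge1)// lerBlDr addrC natr1 leNgt;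
      apply/negP => /ltW.
    by move=> /(dmax (Ordinal d1M)) /=; rewrite ltnn.
  rewrite leq_eqVlt ltnNge -ltnS ltn_ord orbF => /eqP <-.
  rewrite lerBlDr (le_trans (ler_wpM2l _ tT)) ?(ltW q0)//.
  rewrite le_eqVlt; apply/orP; left; apply/eqP.
  by field; rewrite subr_eq0 gt_eqF.
pose t n := iter n next a.
have tP n : 0 <= t n <= T by elim: n => [//|n IHn]; exact: nextP.
pose x n := dig (t n).
have psumE n : psum n x = a - q ^- n * t n.
  elim: n => [|n IHn].
    by rewrite psum0 expr0 invr1 mul1r subrr.
  rewrite psumS IHn /= /next -/(x n) exprS invfM.
  by field; rewrite expf_neq0 gt_eqF.
exists x; apply: cvg_lim => //.
suff : psum n x @[n --> \oo] --> a by [].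
apply/cvgrPdist_lt => e e0.
have e'0 : 0 < e / (T + 1) by rewrite divr_gt0// ltr_wpDl.
near=> n.
rewrite psumE opprB addrCA subrr addr0.
have /andP[tn0 tnT] := tP n.
rewrite ger0_norm ?mulr_ge0 ?(ltW (qV0 n))//.
have : q ^- n < e / (T + 1).
  by near: n; exact: (cvgr_lt _ qV_cvg0).
rewrite ltr_pdivlMr ?ltr_wpDl//; apply: le_lt_trans.
by rewrite ler_wpM2l ?(ltW (qV0 n))// (le_trans tnT)// lerDl.
Unshelve. all: end_near. Qed.

End expansions.

(** * The closed hull of the symbolic univoque set *)

Section closed_hull.
Variables (R : realType) (M : nat) (q : R).
Hypotheses (q1 : 1 < q) (qM : q <= M.+1%:R).
Implicit Types (x y : Omega M).

Local Notation T := (M%:R / (q - 1)).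
Local Notation pi := (expansion_value q).

Let q0 : 0 < q. Proof. exact: lt_trans q1. Qed.
Let qV0 n : 0 < q ^- n. Proof. by rewrite invr_gt0 exprn_gt0. Qed.

(* With strict inequalities this would characterize unique expansions; the
   weak ones give a closed set exceeding [symbolic_univoque_set] only by
   sequences with countably many values. *)
Definition univoque_hull : set (Omega M) :=
  [set x : Omega M | forall n, ((x n < M)%N -> pi (shift n.+1 x) <= 1) /\
                     ((0 < x n)%N -> T - 1 <= pi (shift n.+1 x))].

Lemma univoque_hull_shift x n : univoque_hull x -> univoque_hull (shift n x).
Proof. by move=> Vx m; rewrite shiftD addnS; exact: Vx. Qed.

(** Each condition involves one digit and one tail value. Agreement on [n + 1 + m] digits moves that
    tail value by at most [T * q ^- m], and weak inequalities survive the limit. *)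
Lemma univoque_hull_closed x :
  (forall k, exists2 y, univoque_hull y & mkseq y k = mkseq x k) ->
  univoque_hull x.
Proof.
move=> Hx n.
have near m : exists2 y, univoque_hull y &
    x n = y n /\ `|pi (shift n.+1 x) - pi (shift n.+1 y)| <= T * q ^- m.
  have [y Vy /mkseq_eqP e] := Hx (n.+1 + m)%N.
  exists y => //; split; first by rewrite e// ltn_addr.
  by apply: value_dist => // j jm; rewrite /shift e// ltn_add2l.
have small e : 0 < e -> exists m, T * q ^- m <= e.
  move=> e0; have T1 : 0 < T + 1 by have := tail_ge1 q1 qM; lra.
  have [|m hm] := small_qV q1 (_ : 0 < e / (T + 1)); first by rewrite divr_gt0.
  exists m; move: hm; rewrite ltr_pdivlMr// => /ltW; apply: le_trans.
  by rewrite mulrC ler_wpM2l ?(ltW (qV0 m))// lerDl.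
split=> xn; apply/ler_addgt0Pr => e /small[m hm];
    have [y Vy [xy /le_trans/(_ hm)]] := near m; have [lo hi] := Vy n;
    rewrite ler_norml => /andP[].
  by have := lo; rewrite -xy => /(_ xn); lra.
by have := hi; rewrite -xy => /(_ xn); lra.
Qed.

(** Put [d] in place of [x n] and expand the new remainder afresh: the resulting sequence has the
    value of [x], so uniqueness makes it equal to [x]. *)
Lemma univoque_digit x n (d : 'I_M.+1) : symbolic_univoque_set M q x ->
  0 <= (x n : nat)%:R + pi (shift n.+1 x) - (d : nat)%:R <= T -> d = x n.
Proof.
move=> [_ [z [_ zuniq]]] /(expansion_exists q1 qM)[y ye].
pose x' : Omega M :=
  fun j => if (j < n)%N then x j else if j == n then d else y (j - n.+1)%N.
have x'n : x' n = d by rewrite /x' ltnn eqxx.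
have sx' : shift n.+1 x' = y.
  apply/funext => j; rewrite /shift /x' ltnNge addSnnS leq_addr /=.
  by rewrite -{2}(addn0 n) eqn_add2l /= addnS subSS addKn.
have e : pi x' = pi x.
  rewrite (value_split q1 n x') (value_split q1 n x) (value_shift q1 n x')
    (value_shift q1 n x) x'n sx' ye.
  rewrite [(d : nat)%:R + _]addrC subrK; congr (_ + _).
  by apply: eq_psum => j jn; rewrite /x' jn.
have -> : x = x' by rewrite -(zuniq x)// -(zuniq x').
by rewrite x'n.
Qed.

(** A tail value above 1 would allow raising the preceding digit by one, and a tail value below
    [T - 1] lowering it; both contradict [univoque_digit]. *)
Lemma univoque_sub_hull : symbolic_univoque_set M q `<=` univoque_hull.
Proof.
move=> x Ux n; have T1 := tail_ge1 q1 qM.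
have s0 := value_ge0 q1 (shift n.+1 x); have sT := value_le q1 (shift n.+1 x).
split=> xn; rewrite leNgt; apply/negP => lt1.
  have xn' : ((x n).+1 < M.+1)%N by [].
  have : Ordinal xn' = x n.
    by apply: univoque_digit => //=; rewrite -natr1; apply/andP; split; lra.
  by move=> /(congr1 (@nat_of_ord _)) /=; lia.
have xn' : ((x n).-1 < M.+1)%N by rewrite (leq_ltn_trans (leq_pred _)).
have e : (x n : nat)%:R = (x n).-1%:R + 1 :> R by rewrite natr1 prednK.
have : Ordinal xn' = x n.
  by apply: univoque_digit => //=; rewrite e; apply/andP; split; lra.
by move=> /(congr1 (@nat_of_ord _)) /=; lia.
Qed.

Lemma first_difference x y j : x j <> y j -> exists n,
  [/\ (n <= j)%N, x n <> y n & pi x - pi y =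
      q ^- n.+1 * ((x n : nat)%:R - (y n : nat)%:R +
                   (pi (shift n.+1 x) - pi (shift n.+1 y)))].
Proof.
move=> /eqP xyj; have ex : exists n, x n != y n by exists j.
have [n /eqP xyn nmin] := ex_minnP ex.
exists n; split=> //; first exact: nmin.
rewrite (value_split q1 n x) (value_split q1 n y) (value_shift q1 n x)
  (value_shift q1 n y).
rewrite (@eq_psum _ _ _ n x y); first by rewrite exprS; field;
  rewrite expf_neq0 gt_eqF.
by move=> i ni; apply/eqP; apply: contraTT ni => /nmin; rewrite -leqNgt.
Qed.

Lemma ord_ltnR (i j : 'I_M.+1) : (i < j)%N -> (i : nat)%:R + 1 <= (j : nat)%:R
  :> R.
Proof. by move=> ij; rewrite natr1 ler_nat. Qed.

(** Where a second expansion first differs, the digits differ by at least 1. This forces the tail of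
    [x] to be at least 1 or at most [T - 1], opposite to the hull inequality, so equality holds. The
    value of [x] is then determined by a finite prefix and a bit, which gives countability. *)
Lemma hull_not_univoque x : univoque_hull x -> ~ univoque_set M q (pi x) ->
  exists n (b : bool), pi (shift n x) = if b then 1 else T - 1.
Proof.
move=> Vx nU.
have [y [exy nxy]] : exists y, pi y = pi x /\ y <> x.
  apply: contrapT => ny; apply: nU; split.
    by rewrite /base_interval /= in_itv/= value_ge0// value_le.
  exists x; split => // y ey; apply: contrapT => nyx; apply: ny.
  by exists y; split => // /esym.
have [j nj] : exists j, x j <> y j.
  by apply/existsNP => e; apply: nxy; apply/funext => j; rewrite e.
have [n [_ xyn]] := first_difference nj.
rewrite exy subrr => /esym/eqP; rewrite mulf_eq0 gt_eqF ?qV0//= => /eqP e.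
have y0 := value_ge0 q1 (shift n.+1 y); have yT := value_le q1 (shift n.+1 y).
have [lo hi] := Vx n.
case: (ltngtP (x n) (y n)) => [lt|lt|/val_inj//]; have ltR := ord_ltnR lt.
  exists n.+1, true; have := lo (leq_trans lt (leq_ord (y n))) => ?.
  by apply/eqP; rewrite eq_le; apply/andP; split; lra.
exists n.+1, false; have := hi (leq_ltn_trans (leq0n _) lt) => ?.
by apply/eqP; rewrite eq_le; apply/andP; split; lra.
Qed.

(** At the first difference the smaller digit is below [M] and the larger one positive, so their
    tails are at most 1 and at least [T - 1]; a digit gap of at least 1 leaves [1 + (T - 1) - 1]. *)
Lemma hull_gap x y j k : univoque_hull x -> univoque_hull y ->
  (j < k)%N -> x j <> y j -> (T - 1) * q ^- k <= `|pi x - pi y|.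
Proof.
move=> Vx Vy jk /first_difference[n [nj xyn ->]].
have T1 := tail_ge1 q1 qM.
rewrite normrM gtr0_norm// mulrC.
have qle : q ^- k <= q ^- n.+1.
  rewrite lef_pV2 ?posrE ?exprn_gt0// ler_eXn2l//.
  exact: leq_ltn_trans nj jk.
have Mge (i i' : 'I_M.+1) : (i < i')%N -> (i < M)%N /\ (0 < i')%N.
  by move=> ii'; have := ltn_ord i'; split; lia.
have [lox hix] := Vx n; have [loy hiy] := Vy n.
apply: ler_pM => //; [exact: ltW|by lra|].
case: (ltngtP (x n) (y n)) => [lt|lt|/val_inj//]; have ltR := ord_ltnR lt;
  have [lM gt0] := Mge _ _ lt.
  by rewrite ler_normr; apply/orP; right; have := lox lM; have := hiy gt0; lra.
by rewrite ler_normr; apply/orP; left; have := loy lM; have := hix gt0; lra.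
Qed.

End closed_hull.

(** * Separation of cylinders by values *)

Section separation.
Variables (R : realType) (M : nat) (q : R).
Hypotheses (q1 : 1 < q) (qM : q <= M.+1%:R).
Implicit Types (x y : Omega M).

Local Notation T := (M%:R / (q - 1)).
Local Notation pi := (expansion_value q).

Let q0 : 0 < q. Proof. exact: lt_trans q1. Qed.
Let qV0 n : 0 < q ^- n. Proof. by rewrite invr_gt0 exprn_gt0. Qed.

(** Horner's rule in base [M + 1], first digit leading: the position of a cylinder among those of
    level [k]. *)
Fixpoint word_number x k : nat :=
  if k is k'.+1 then (word_number x k' * M.+1 + x k')%N else 0%N.

Lemma word_number_inj x y k : word_number x k = word_number y k ->
  mkseq x k = mkseq y k.
Proof.
elim: k => [//|k IHk] /= e; rewrite !mkseqS.
have xk := ltn_ord (x k); have yk := ltn_ord (y k).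
rewrite IHk; last first.
  by have := congr1 (divn^~ M.+1) e; rewrite !divnMDl// !divn_small// !addn0.
congr rcons; apply/val_inj => /=.
by have := congr1 (modn^~ M.+1) e; rewrite !modnMDl !modn_small.
Qed.

Lemma psum_word_number x k : q = M.+1%:R ->
  psum q k x = (word_number x k)%:R * q ^- k.
Proof.
move=> qE; elim: k => [|k IHk]; first by rewrite psum0 mul0r.
rewrite psumS IHk /= natrD natrM -qE exprS.
by field; rewrite expf_neq0 gt_eqF.
Qed.

Lemma mem_neighbours (m n : nat) : (m < n.+2)%N -> (n < m.+2)%N ->
  n \in [:: m.-1; m; m.+1].
Proof. by rewrite !inE; lia. Qed.

(* For [q < M + 1] one word suffices; in the integer base [M + 1] adjacent
   cylinders touch, and a short interval may meet several of them. *)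
Lemma cylinder_cover : exists2 c : R, 0 < c &
  forall k (E : set R), (forall a b, E a -> E b -> `|a - b| < c * q ^- k) ->
  exists L : seq (seq 'I_M.+1),
    [/\ (size L <= 3)%N, forall w, w \in L -> size w = k &
        forall x, univoque_hull q x -> E (pi x) ->
          exists2 w, w \in L & occurs w x].
Proof.
have T1 := tail_ge1 q1 qM.
have [qlt|qge] := ltP q M.+1%:R.
  (* The gap constant of [hull_gap], positive because [q < M + 1]. *)
  exists (T - 1); first by rewrite subr_gt0 ltr_pdivlMr ?subr_gt0//
    mul1r ltrBlDr natr1.
  move=> k E Esmall.
  have [[x0 Vx0 Ex0]|noE] :=
    pselect (exists2 x : Omega M, univoque_hull q x & E (pi x)).
    exists [:: mkseq x0 k]; split=> //; first by move=> w /[!inE]/eqP->;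
      rewrite size_mkseq.
    move=> x Vx Ex; exists (mkseq x0 k); first by rewrite inE.
    rewrite /occurs size_mkseq; apply/mkseq_eqP => j jk; apply: contrapT => ne.
    by have := hull_gap q1 qM Vx Vx0 jk ne; rewrite leNgt Esmall.
  by exists [::]; split=> // x Vx Ex; case: noE; exists x.
have qE : q = M.+1%:R by apply/eqP; rewrite eq_le qM.
have TE : T <= 1 by rewrite ler_pdivrMr ?subr_gt0// qE -natr1; lra.
exists 1 => // k E Esmall.
(* Decodes a number into its word; a number that no word has is sent to the zero word, only to keep
   the length [k]. *)
have /choice[word wordP] : forall m, exists w : seq 'I_M.+1,
    size w = k /\ forall x, word_number x k = m -> mkseq x k = w.
  move=> m; have [[x xm]|nx] :=
    pselect (exists x : Omega M, word_number x k = m).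
    by exists (mkseq x k); rewrite size_mkseq; split => // y ym;
      apply: word_number_inj; rewrite ym.
  exists (nseq k ord0); rewrite size_nseq; split=> // x xm.
  by case: nx; exists x.
have [[x0 Vx0 Ex0]|noE] :=
  pselect (exists2 x : Omega M, univoque_hull q x & E (pi x)); last first.
  by exists [::]; split=> // x Vx Ex; case: noE; exists x.
pose n0 := word_number x0 k.
exists [seq word m | m <- [:: n0.-1; n0; n0.+1]]; split=> //.
  by move=> _ /mapP[m _ ->]; case: (wordP m).
move=> x Vx Ex; exists (word (word_number x k)); last first.
  by have [sz /(_ x erefl)] := wordP (word_number x k); rewrite /occurs sz.
(* After scaling by [q ^ k] the values differ by less than 1, and the tails, lying in [[0, 1]], by
   at most 1. The word numbers then differ by less than 2. *)
apply: map_f; have := Esmall _ _ Ex Ex0.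
rewrite mul1r (value_split q1 k x) (value_split q1 k x0) !psum_word_number//.
rewrite [_ * q ^- k]mulrC [_ * q ^- k in X in _ - X]mulrC -!mulrDr -mulrBr.
rewrite normrM gtr0_norm// gtr_pMr// ltr_norml => /andP[lo hi].
have s0 := value_ge0 q1 (shift k x); have sT := value_le q1 (shift k x).
have t0 := value_ge0 q1 (shift k x0); have tT := value_le q1 (shift k x0).
have : ((word_number x k)%:R < n0.+2%:R :> R) by rewrite -!natr1;
  rewrite -/n0 in lo hi; lra.
have : (n0%:R < (word_number x k).+2%:R :> R) by rewrite -!natr1;
  rewrite -/n0 in lo hi; lra.
rewrite !ltr_nat; exact: mem_neighbours.
Qed.

End separation.

(** * Diameters and covers of null sets *)

Section diameter.
Variable R : realType.
Implicit Types (E : set R) (s d : R).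

Lemma diameter_le E d : (diameter E <= d%:E)%E <->
  forall a b, E a -> E b -> `|a - b| <= d.
Proof.
split=> [dE a b Ea Eb|H].
  rewrite -lee_fin (le_trans _ dE)//; apply: ereal_sup_ubound.
  by exists (a, b).
by apply: ge_ereal_sup => _ [[a b] [/= Ea Eb] <-]; rewrite lee_fin; exact: H.
Qed.

Lemma diameter_ge0 E : E !=set0 -> (0 <= diameter E)%E.
Proof.
by move=> [a Ea]; apply: ereal_sup_ubound; exists (a, a) => //=;
  rewrite subrr normr0.
Qed.

Lemma diameter_pow_ge0 s E : (0 <= diameter_pow s E)%E.
Proof. by rewrite /diameter_pow; case: ifP => // _; exact: poweR_ge0. Qed.

Lemma diameter_powE s E d : E !=set0 -> (diameter E <= d%:E)%E ->
  exists2 e : R, 0 <= e <= d & diameter E = e%:E /\ diameter_pow s E = (e `^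
    s)%:E.
Proof.
move=> E0 Ed; have := diameter_ge0 E0; move: Ed; rewrite /diameter_pow.
case: ifPn => [/eqP E00|_]; first by case: E0 => a; rewrite E00.
case: (diameter E) => [e| |]//; rewrite !lee_fin => ed e0.
by exists e; rewrite ?e0.
Qed.

Lemma diameter_pow_fin s E d : (diameter E <= d%:E)%E ->
  diameter_pow s E \is a fin_num.
Proof.
have [->|/set0P E0 Ed] := eqVneq E set0; first by rewrite /diameter_pow eqxx.
by have [e _ [_ ->]] := diameter_powE s E0 Ed.
Qed.

Lemma null_measure_cover s (A : set R) d (e : R) : hausdorff_measure s A = 0%E
  ->
  0 < d -> 0 < e -> exists2 U : (set R)^nat, delta_cover d A U &
    (\sum_(0 <= i <oo) diameter_pow s (U i) < e%:E)%E.
Proof.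
move=> H0 d0 e0.
have : (hausdorff_premeasure s d A < e%:E)%E.
  rewrite (@le_lt_trans _ _ 0%E) ?lte_fin// -H0.
  by apply: ereal_sup_ubound; exists d.
by move=> /ereal_inf_lt[_ [U UA <-] ltU]; exists U.
Qed.

End diameter.

(** * From a null measure to a bound on block counts *)

Section lower_bound.
Variables (R : realType) (M : nat) (q : R).
Hypotheses (q1 : 1 < q) (qM : q <= M.+1%:R).
Variables (s0 s : R).
Hypotheses (s00 : 0 <= s0) (s0s : s0 <= s) (sgt0 : 0 < s).

Local Notation T := (M%:R / (q - 1)).
Local Notation pi := (expansion_value q).
Local Notation r := (q `^ (- s)).
Local Notation V := (univoque_hull (M := M) q).

Let q0 : 0 < q. Proof. exact: lt_trans q1. Qed.
Let qV0 n : 0 < q ^- n. Proof. by rewrite invr_gt0 exprn_gt0. Qed.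
Let r0 : 0 < r. Proof. exact: powR_gt0. Qed.
Let r1 : r < 1.
Proof.
rewrite /powR gt_eqF// expR_lt1 mulNr oppr_lt0 mulr_gt0// ln_gt0//.
Qed.

(** Compares word weights with diameter powers. The measure is taken at [s0], which may be 0;
    weights use [s >= s0] with [s > 0], so that [r < 1] and long words are cheap. *)
Lemma base_pow_le k : r ^+ k <= (q ^- k) `^ s0.
Proof.
rewrite -(powR_mulrn k (ltW r0)) -(powR_invn k (ltW q0)) -!powRrM.
by apply: ler_powR; rewrite ?(ltW q1)// !mulNr lerN2 mulrC ler_wpM2r.
Qed.

Lemma small_base_pow e : 0 < e -> exists n, r ^+ n < e.
Proof.
move=> e0.
have rc : r ^+ n @[n --> \oo] --> 0 by apply: cvg_expr; rewrite gtr0_norm.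
have [N _ /(_ N (leqnn _))] := cvgr_lt _ rc _ e0.
by exists N.
Qed.

Lemma sum_words_le (k : nat) (L : seq (seq 'I_M.+1)) :
  (size L <= 3)%N -> (forall w, w \in L -> size w = k) ->
  \sum_(w <- L) r ^+ size w <= 3 * r ^+ k.
Proof.
move=> L3 Lk; rewrite big_seq (eq_bigr (fun=> r ^+ k)); last by move=> w /Lk->.
rewrite -big_seq big_const_seq count_predT iter_addr_0 -[leLHS]mulr_natl
  ler_wpM2r//.
  by rewrite exprn_ge0// ltW.
by rewrite ler_nat.
Qed.

(** At every length three words suffice, and their weight tends to 0. This serves the exceptional
    points and the sets of diameter zero in a cover. *)
Lemma point_words (E : set R) (e : R) : 0 < e ->
  (forall a b, E a -> E b -> a = b) ->
  exists L : seq (seq 'I_M.+1), [/\ forall w, w \in L -> (0 < size w)%N,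
    forall x, V x -> E (pi x) -> exists2 w, w \in L & occurs w x &
    \sum_(w <- L) r ^+ size w <= e].
Proof.
move=> e0 E1; have [c c0 Hc] := cylinder_cover q1 qM.
have [|n rn] := small_base_pow (_ : 0 < e / 3); first by rewrite divr_gt0.
have [|L [L3 Ln Lcov]] := Hc n.+1 E.
  by move=> a b Ea /(E1 _ _ Ea) ->; rewrite subrr normr0 mulr_gt0.
exists L; split=> //; first by move=> w /Ln->.
rewrite (le_trans (sum_words_le L3 Ln))// exprS.
move: rn; rewrite ltr_pdivlMr// mulrC => /ltW; apply: le_trans.
by rewrite ler_wpM2l// ler_piMl ?exprn_ge0 ?ltW.
Qed.

(** For a set of diameter [d > 0], take the [k] with [c * q ^- k <= d < c * q ^- k.-1]: at most
    three words of length [k.-1] cover it, with weight comparable to [d] to the power [s0]. The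
    slack [e] pays for empty sets and single points. *)
Lemma small_set_words : exists C d : R, [/\ 0 < C, 0 < d &
  forall (E : set R) (e : R), 0 < e -> (diameter E <= d%:E)%E ->
  exists L : seq (seq 'I_M.+1), [/\ forall w, w \in L -> (0 < size w)%N,
    forall x, V x -> E (pi x) -> exists2 w, w \in L & occurs w x &
    \sum_(w <- L) r ^+ size w <= C * fine (diameter_pow s0 E) + e]].
Proof.
have [c c0 Hc] := cylinder_cover q1 qM.
(* The factor 3 counts words, [r^-1] pays for length [k.-1] instead of [k], and the power of [c^-1]
   rescales [d]. The threshold [c * q ^- 2] forces [k >= 2], so the words are nonempty. *)
exists (3 * r^-1 * c^-1 `^ s0), (c * q ^- 2); split.
- by rewrite !mulr_gt0// ?invr_gt0 ?powR_gt0// invr_gt0.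
- by rewrite mulr_gt0.
move=> E e e0 Ed.
have pointE : (forall a b, E a -> E b -> a = b) -> exists L : seq (seq 'I_M.+1),
    [/\ forall w, w \in L -> (0 < size w)%N,
        forall x, V x -> E (pi x) -> exists2 w, w \in L & occurs w x &
        \sum_(w <- L) r ^+ size w <=
          3 * r^-1 * c^-1 `^ s0 * fine (diameter_pow s0 E) + e].
  move=> /(point_words e0)[L [L1 L2 L3]]; exists L; split=> //.
  rewrite (le_trans L3)// lerDr mulr_ge0 ?fine_ge0 ?diameter_pow_ge0//.
  by rewrite !mulr_ge0 ?powR_ge0// invr_ge0 ltW.
have [E0|/set0P E0] := eqVneq E set0; first by apply: pointE => a b; rewrite E0.
have [d /andP[d0 dle] [Edia Epow]] := diameter_powE s0 E0 Ed.
have Edist a b : E a -> E b -> `|a - b| <= d.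
  by move: a b; apply/diameter_le; rewrite Edia.
have [d00|dgt0] := eqVneq d 0.
  apply: pointE => a b Ea /(Edist _ _ Ea).
  by rewrite d00 normr_le0 subr_eq0 => /eqP.
have {}d0 : 0 < d by rewrite lt_neqAle eq_sym dgt0.
have ex : exists k, c * q ^- k <= d.
  have [|k hk] := small_qV q1 (_ : 0 < d / c); first by rewrite divr_gt0.
  by exists k; move: hk; rewrite ltr_pdivlMr// mulrC => /ltW.
have [k kd kmin] := ex_minnP ex.
have k2 : (1 < k)%N.
  rewrite ltnNge; apply/negP => k1.
  have := le_trans kd dle; rewrite ler_pM2l// lef_pV2 ?posrE ?exprn_gt0//.
  by rewrite ler_eXn2l// leqNgt ltnS k1.
have kd' : d < c * q ^- k.-1.
  by rewrite ltNge; apply/negP => /kmin; rewrite leqNgt ltn_predL ltnW.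
have [|L [L3 Lk Lcov]] := Hc k.-1 E.
  by move=> a b Ea Eb; rewrite (le_lt_trans (Edist _ _ Ea Eb)).
exists L; split=> //; first by move=> w /Lk->; rewrite -ltnS (ltn_predK k2).
rewrite Epow (le_trans (sum_words_le L3 Lk))//
  (@le_trans _ _ (3 * r^-1 * c^-1 `^ s0 * d `^ s0))//.
  rewrite -!mulrA ler_wpM2l// -powRM ?(ltW d0) ?invr_ge0 ?(ltW c0)//.
  have -> : r ^+ k.-1 = r^-1 * r ^+ k.
    by rewrite -{2}(prednK (ltnW k2)) exprS mulKf// gt_eqF.
  rewrite ler_wpM2l ?invr_ge0 ?(ltW r0)// (le_trans (base_pow_le k))//.
  apply: ge0_ler_powR => //;
    rewrite ?nnegrE ?(ltW (qV0 _)) ?mulr_ge0 ?invr_ge0 ?(ltW c0) ?(ltW d0)//.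
  by rewrite mulrC ler_pdivlMr// mulrC.
by rewrite /= lerDl ltW.
Qed.

Lemma null_measure_count : hausdorff_measure s0 (univoque_set M q) = 0%E ->
  exists C : R, forall k,
    #|blocks k (symbolic_univoque_set M q)|%:R * r ^+ k <= C.
Proof.
move=> H0; have [C [d [C0 d0 HC]]] := small_set_words.
have [|U [UA Ud] Usum] := null_measure_cover H0 d0 (_ : 0 < (4 * C)^-1).
  by rewrite invr_gt0 mulr_gt0.
(* Weight budget: the cover costs at most 1/4 through [(4 * C)^-1], and the slacks [eta i], spent
   twice for each [i], at most 1/2. *)
pose eta i : R := (2^-1) ^+ (i.+3).
have eta0 i : 0 < eta i by rewrite exprn_gt0.
(* Enumerates all candidate exceptional values of [hull_not_univoque], coded by a prefix and a bit;
   the default digit in [nth] is never read by [psum]. *)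
pose p i : R := if unpickle i is Some (u, b) then
    psum q (size (u : seq 'I_M.+1)) (nth ord0 u) +
    q ^- (size u) * (if b then 1 else T - 1) else 0.
have /choice[L1 HL1] := fun i => HC (U i) (eta i) (eta0 i) (Ud i).
have /choice[L2 HL2] : forall i, exists L : seq (seq 'I_M.+1),
    [/\ forall w, w \in L -> (0 < size w)%N,
    forall x, V x -> pi x = p i -> exists2 w, w \in L & occurs w x &
    \sum_(w <- L) r ^+ size w <= eta i].
  by move=> i; apply: (@point_words [set p i]) => // a b -> ->.
have [|N HN] := @finite_subcover _ V (fun i => L1 i ++ L2 i)
  (univoque_hull_closed q1 qM).
  move=> x Vx; have [Ux|nUx] := pselect (univoque_set M q (pi x)).
    have [i _ Ui] := UA _ Ux; have [_ /(_ _ Vx Ui)[w wL wx] _] := HL1 i.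
    by exists i, w => //; rewrite mem_cat wL.
  have [n [b e]] := hull_not_univoque q1 Vx nUx.
  have pe : pi x = p (pickle (mkseq x n, b)).
    rewrite /p pickleK size_mkseq (value_split q1 n) e; congr (_ + _).
    by apply: eq_psum => j jn; rewrite nth_mkseq.
  have [_ /(_ _ Vx pe)[w wL wx] _] := HL2 (pickle (mkseq x n, b)).
  by exists (pickle (mkseq x n, b)), w => //; rewrite mem_cat wL orbT.
pose W := flatten [seq L1 i ++ L2 i | i <- iota 0 N].
have WP w : w \in W -> exists i, w \in L1 i ++ L2 i.
  by move=> /flattenP[_ /mapP[i _ ->] wL]; exists i.
have W1 : \sum_(w <- W) r ^+ size w <= 1.
  rewrite big_flatten big_map /=.
  apply: (@le_trans _ _ (\sum_(i <- iota 0 N)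
      (C * fine (diameter_pow s0 (U i)) + (eta i + eta i)))).
    apply: ler_sum => i _; rewrite big_cat /= addrA.
    by have [_ _ ?] := HL1 i; have [_ _ ?] := HL2 i; apply: lerD.
  rewrite big_split -mulr_sumr /=.
  have etaS n : \sum_(i <- iota 0 n) (eta i + eta i) <= 1 / 2 - 4 * eta n.
    elim: n => [|n IHn]; first by rewrite big_nil /eta; lra.
    rewrite -addn1 iotaD big_cat /= big_seq1 add0n addn1.
    have : eta n = 2 * eta n.+1 by rewrite /eta [in RHS]exprS mulrA divff//
      mul1r.
    by have := eta0 n; lra.
  have : C * \sum_(i <- iota 0 N) fine (diameter_pow s0 (U i)) <= 1 / 4.
    have dlt : \sum_(i <- iota 0 N) fine (diameter_pow s0 (U i)) <= (4 * C)^-1.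
      rewrite -lee_fin -sumEFin (le_trans _ (ltW Usum))//.
      rewrite [leLHS](_ : _ = \sum_(0 <= i < N) diameter_pow s0 (U i))%E.
        by apply: nneseries_lim_ge => i _ _; exact: diameter_pow_ge0.
      rewrite /index_iota subn0; apply: eq_bigr => i _.
      by rewrite fineK// (diameter_pow_fin _ (Ud i)).
    rewrite (le_trans (ler_wpM2l (ltW C0) dlt))//.
    by rewrite invfM mulrCA divff ?gt_eqF// mulr1 mul1r.
  by have := etaS N; have := eta0 N; lra.
have [||||B HB] := @prefix_count _ R V r W _ _ _ _ W1.
- by rewrite !ltW.
- by move=> x n; exact: univoque_hull_shift.
- move=> w /WP[i]; rewrite mem_cat => /orP[].
    by have [h _ _] := HL1 i; exact: h.
  by have [h _ _] := HL2 i; exact: h.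
- move=> x /HN[i iN [w wL wx]]; exists w => //.
  apply/flattenP; exists (L1 i ++ L2 i) => //.
  by apply: (map_f (fun i => L1 i ++ L2 i)); rewrite mem_iota add0n iN.
(* A block at position [i] is a prefix of the shifted sequence, which stays in the hull. *)
exists B => k; have := HB k [seq val w | w <- enum (blocks k
  (symbolic_univoque_set M q))].
rewrite size_map -cardE; apply.
  by rewrite map_inj_uniq ?enum_uniq//; exact: val_inj.
move=> _ /mapP[w + ->]; rewrite mem_enum inE => /asboolP[x [Ux [i ->]]].
exists (shift i x); last exact/esym/val_block.
exact/univoque_hull_shift/univoque_sub_hull.
Qed.

End lower_bound.

(** * Cylinder covers and null measures *)

Section upper_bound.
Variables (R : realType) (M : nat) (q : R).
Hypotheses (q1 : 1 < q) (qM : q <= M.+1%:R).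

Local Notation T := (M%:R / (q - 1)).
Local Notation pi := (expansion_value q).
Local Notation B k := (blocks k (symbolic_univoque_set M q)).

Definition block_growth (k : nat) : R := ln #|B k|%:R / k%:R.

Let q0 : 0 < q. Proof. exact: lt_trans q1. Qed.

Lemma block_growth_ge0 k : 0 <= block_growth k.
Proof.
rewrite /block_growth divr_ge0//; case: #|_| => [|n]; first by rewrite ln0.
by rewrite ln_ge0// ler1n.
Qed.

(** Supplies an exponent of measure zero, hence a finite dimension. At [k = 0] the quotient is 0 by
    convention, as is [ln 0]. *)
Lemma block_growth_le k : block_growth k <= ln M.+1%:R.
Proof.
have lnM0 : 0 <= ln M.+1%:R :> R by rewrite ln_ge0// ler1n.
rewrite /block_growth; case: k => [|k]; first by rewrite invr0 mulr0.
rewrite ler_pdivrMr ?ltr0n// mulr_natr -lnXn ?ltr0n// -natrX.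
case: (posnP #|B k.+1|) => [->|B0].
  by rewrite ln0// ln_ge0// ler1n expn_gt0.
rewrite ler_ln ?posrE ?ltr0n ?expn_gt0// ler_nat.
by rewrite (leq_trans (max_card _))// card_tuple card_ord.
Qed.

Lemma hausdorff_measure_ge0 s (A : set R) : (0 <= hausdorff_measure s A)%E.
Proof.
apply: (@le_trans _ _ (hausdorff_premeasure s 1 A)).
  apply: le_ereal_inf_tmp => _ [U _ <-].
  by apply: nneseries_ge0 => i _ _; exact: diameter_pow_ge0.
by apply: ereal_sup_ubound; exists 1 => //=.
Qed.

(** Each point of the set lies in the cylinder of the initial block of its expansion, and a cylinder
    of level [k] has diameter at most [T * q ^- k]. *)
Lemma cylinder_premeasure s d k : 0 <= s -> T * q ^- k <= d ->
  (hausdorff_premeasure s d (univoque_set M q) <=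
    (#|B k|%:R * (T * q ^- k) `^ s)%:E)%E.
Proof.
move=> s0 Td.
have D0 : 0 <= T * q ^- k.
  by rewrite mulr_ge0 ?divr_ge0 ?subr_ge0 ?(ltW q1) ?invr_ge0 ?exprn_ge0 ?(ltW
    q0).
pose cyl (w : k.-tuple 'I_M.+1) : set R :=
  [set pi x | x in [set x : Omega M | mkseq x k = w]].
pose U i : set R := nth set0 [seq cyl w | w <- enum (B k)] i.
have Udiam i : (diameter (U i) <= (T * q ^- k)%:E)%E.
  apply/diameter_le => a b; rewrite /U.
  have [iB|iB] := ltnP i (size (enum (B k))); last first.
    by rewrite nth_default ?size_map.
  have [w0 _] : exists w : k.-tuple 'I_M.+1, True.
    by case: (enum (B k)) iB => // w ? _; exists w.
  rewrite (nth_map w0)// => -[x xw <-] [y yw <-]; apply: value_dist => //.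
  by apply/mkseq_eqP; rewrite xw yw.
have Ucov : delta_cover d (univoque_set M q) U.
  split=> [a Ua|i]; last by rewrite (le_trans (Udiam i))// lee_fin.
  have [_ [x [xa _]]] := Ua.
  have xB : block k x 0 \in B k.
    by rewrite inE; apply/asboolP; exists x; split;
      [rewrite /symbolic_univoque_set/= xa|exists 0%N].
  exists (index (block k x 0) (enum (B k))) => //; rewrite /U.
  rewrite (nth_map (block k x 0)) ?index_mem ?mem_enum// nth_index ?mem_enum//.
  by exists x => //; exact/esym/(val_block k x 0).
apply: (@le_trans _ _ (\sum_(0 <= i <oo) diameter_pow s (U i))%E).
  by apply: ereal_inf_lbound; exists U.
rewrite (nneseries_split 0 #|B k|); last by move=> i _; exact: diameter_pow_ge0.
(* The padding sets are empty and weigh 0 even at [s = 0]. *)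
rewrite eseries0 ?adde0; last first.
  move=> i Bi _; rewrite /U nth_default ?size_map -?cardE//.
  by rewrite /diameter_pow eqxx.
apply: (@le_trans _ _ (\sum_(0 <= i < 0 + #|B k|) ((T * q ^- k) `^ s)%:E)%E).
  apply: lee_sum => i _; have [->|/set0P U0] := eqVneq (U i) set0.
    by rewrite /diameter_pow eqxx lee_fin powR_ge0.
  have [e /andP[e0 eT] [_ ->]] := diameter_powE s U0 (Udiam i).
  by rewrite lee_fin ge0_ler_powR.
by rewrite sumEFin lee_fin big_const_nat add0n subn0 iter_addr_0
  [leRHS]mulr_natl.
Qed.

Lemma null_measure_of_growth s t : 0 <= s -> t < s * ln q ->
  (forall N, exists2 k, (N <= k)%N & block_growth k <= t) ->
  hausdorff_measure s (univoque_set M q) = 0%E.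
Proof.
move=> s0 ts freq; apply/eqP; rewrite eq_le hausdorff_measure_ge0 andbT.
apply: ge_ereal_sup => _ [d d0 <-]; apply/lee_addgt0Pr => e e0; rewrite add0e.
have T0 : 0 < T by rewrite (lt_le_trans ltr01)// tail_ge1.
pose rho := expR (t - s * ln q).
have rho1 : `|rho| < 1 by rewrite gtr0_norm ?expR_gt0// expR_lt1 subr_lt0.
have [N _ HN] : \forall k \near \oo, q ^- k < d / T /\ rho ^+ k < e / T `^ s.
  near=> k; split; near: k.
    by apply: (cvgr_lt _ (qV_cvg0 q1)); rewrite divr_gt0.
  by apply: (cvgr_lt _ (cvg_expr rho1)); rewrite divr_gt0// powR_gt0.
have [k Nk kt] := freq N.+1; have [qk rk] := HN k (ltnW Nk).
have k0 : (0 < k)%N by exact: leq_ltn_trans Nk.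
rewrite (le_trans (cylinder_premeasure (k := k) s0 _))//.
  by rewrite mulrC -ler_pdivlMr// ltW.
rewrite lee_fin (@le_trans _ _ (T `^ s * rho ^+ k))//; last first.
  by rewrite mulrC -ler_pdivlMr ?powR_gt0// ltW.
have Bk : #|B k|%:R <= expR (t * k%:R) :> R.
  case: (posnP #|B k|) => [->|B0]; first exact: expR_ge0.
  rewrite -[leLHS]lnK ?posrE ?ltr0n// ler_expR.
  by rewrite -ler_pdivrMr ?ltr0n.
have qk0 : 0 <= q ^- k by rewrite invr_ge0 exprn_ge0 ?ltW.
rewrite powRM ?(ltW T0)// mulrCA ler_wpM2l ?powR_ge0//.
rewrite (le_trans (ler_wpM2r (powR_ge0 _ _) Bk))//.
rewrite -(powR_invn k (ltW q0)) -powRrM /powR gt_eqF//.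
rewrite le_eqVlt; apply/orP; left; apply/eqP.
by rewrite -expRD /rho -expRM_natr; congr expR; ring.
Unshelve. all: end_near. Qed.

End upper_bound.


(** * The dimension formula *)

Theorem theorem1p2 (R : realType) (M : nat) (hM : (1 <= M)%N)
    (q : R) (hq1 : 1 < q) (hqM : q <= M.+1%:R) :
  hausdorff_dim (univoque_set M q) =
  (entropy R (symbolic_univoque_set M q) / ln q)%:E.
Proof.
have q0 : 0 < q := lt_trans ltr01 hq1.
have lnq : 0 < ln q by rewrite ln_gt0.
set a := block_growth M q.
have dim_le s : 0 <= s -> hausdorff_measure s (univoque_set M q) = 0%E ->
    (hausdorff_dim (univoque_set M q) <= s%:E)%E.
  by move=> s0 Hs; apply: ereal_inf_lbound; exists s.
have dim_ge0 : (0 <= hausdorff_dim (univoque_set M q))%E.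
  by apply: le_ereal_inf_tmp => _ [s [s0 _] <-]; rewrite lee_fin.
have [D D0 DE] : exists2 D : R, 0 <= D & hausdorff_dim (univoque_set M q) =
  D%:E.
  pose s := (ln M.+1%:R + 1) / ln q.
  have lnM0 : 0 <= ln M.+1%:R :> R by rewrite ln_ge0// ler1n.
  have s0 : 0 <= s by rewrite divr_ge0 ?addr_ge0// ltW.
  have : (hausdorff_dim (univoque_set M q) <= s%:E)%E.
    apply: dim_le => //; apply: (@null_measure_of_growth _ _ _ hq1 hqM _ (ln
      M.+1%:R)) => //.
      by rewrite divfK ?gt_eqF// ltrDl.
    by move=> N; exists N => //; exact: block_growth_le.
  move: dim_ge0; case: (hausdorff_dim _) => [D| |]//; rewrite lee_fin => D0 _.
  by exists D.
(* Half of [e] goes into an exponent [D + e / 2] above some exponent of null measure; the other half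
   absorbs the constant [C'] for large [k]. *)
have growth_le e : 0 < e -> \forall k \near \oo, a k <= (D + e) * ln q.
  move=> e0; have e20 : 0 < e / 2 by rewrite divr_gt0.
  have /ereal_inf_lt[_ [s0 [s00 Hs0] <-]] :
      (hausdorff_dim (univoque_set M q) < (D + e / 2)%:E)%E.
    by rewrite DE lte_fin ltrDl.
  rewrite lte_fin => /ltW s0s.
  have sgt0 : 0 < D + e / 2 by rewrite ltr_wpDl.
  have [C HC] := null_measure_count hq1 hqM s00 s0s sgt0 Hs0.
  pose C' := Num.max C 1.
  have C'0 : 0 < C' by rewrite lt_max ltr01 orbT.
  have lnC0 : 0 <= ln C' by rewrite ln_ge0// le_max lexx orbT.
  have small : \forall k \near \oo, ln C' / (e / 2 * ln q) <= k%:R :> R.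
    exact: nbhs_infty_ger.
  near=> k.
  have k0 : (0 < k)%N by near: k; exact: nbhs_infty_gt.
  have : ln C' / (e / 2 * ln q) <= k%:R by near: k; exact: small.
  rewrite ler_pdivrMr ?mulr_gt0// => lnCk.
  rewrite /a /block_growth ler_pdivrMr ?ltr0n//.
  case: (posnP #|blocks k (symbolic_univoque_set M q)|) => [->|B0].
    by rewrite ln0// mulr_ge0// mulr_ge0 ?(ltW lnq)// addr_ge0// ltW.
  have : #|blocks k (symbolic_univoque_set M q)|%:R <= C' * q `^ ((D + e / 2)
    * k%:R).
    have := HC k; rewrite -powR_mulrn ?powR_ge0// -powRrM mulNr powRN.
    rewrite ler_pdivrMr ?powR_gt0// => /le_trans; apply.
    by rewrite ler_wpM2r ?powR_ge0// le_max lexx.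
  rewrite -ler_ln ?posrE ?ltr0n ?mulr_gt0 ?powR_gt0// lnM ?posrE ?powR_gt0//.
  rewrite ln_powR => /le_trans; apply.
  by nra.
(* Otherwise the growth is at most [(D - e) * ln q] for arbitrarily large [k], and the measure
   vanishes at [D - e / 2], below the dimension. *)
have growth_ge e : 0 < e -> \forall k \near \oo, (D - e) * ln q <= a k.
  move=> e0; apply: contrapT => nP.
  have freq N : exists2 k, (N <= k)%N & a k <= (D - e) * ln q.
    apply: contrapT => nk; apply: nP; exists N => // k /= Nk.
    by rewrite leNgt; apply/negP => /ltW lt; apply: nk; exists k.
  have [k _ ak] := freq 0%N.
  (* Nonnegativity of the growth rate keeps the exponent admissible, since the dimension ranges over
     [s >= 0] only. *)
  have De0 : 0 <= D - e.
    by rewrite -(pmulr_lge0 _ lnq) (le_trans _ ak)// block_growth_ge0.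
  have : (D%:E <= (D - e / 2)%:E)%E.
    rewrite -DE; apply: dim_le; first by lra.
    apply: (@null_measure_of_growth _ _ _ hq1 hqM _ ((D - e) * ln q)) => //.
      by lra.
    by rewrite ltr_pM2r//; lra.
  by rewrite lee_fin; lra.
have a_cvg : a k @[k --> \oo] --> D * ln q.
  apply/cvgrPdist_le => e e0; have e'0 : 0 < e / ln q by rewrite divr_gt0.
  near=> k.
  have : a k <= (D + e / ln q) * ln q by near: k; exact: growth_le.
  have : (D - e / ln q) * ln q <= a k by near: k; exact: growth_ge.
  rewrite mulrBl mulrDl divfK ?gt_eqF// => lo hi.
  by rewrite ler_norml; apply/andP; split; lra.
have -> : entropy R (symbolic_univoque_set M q) = D * ln q
  by exact: cvg_lim a_cvg.
by rewrite mulfK ?gt_eqF.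
Unshelve. all: end_near. Qed.
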